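(* Let $\lambda>0$ and let $\sigma_1,\sigma_2,\ldots$ be i.i.d. positive random variables (service times) with density $g$, distribution function $G$, complementary distribution function $\overline{G}=1-G$, and finite moments of all orders. Let $f$ denote the invariant density of the stationary stage length, i.e. the density of the stationary probability distribution of the Markov chain on $[0,\infty)$ with transition density $$q(x,y)=\left(\lambda x e^{-\lambda x\overline{G}(y)}+e^{-\lambda x}\right)g(y),\qquad x,y\ge 0,$$ and let $\beta_k:=\int_0^\infty x^k f(x)\,dx$, $k=1,2,\ldots$, denote its moments (which exist). Define $$\gamma_{m,k}:=\mathbb{E}[\min(\sigma_1,\sigma_2,\ldots,\sigma_k)^m].$$ Then the moments $\beta_i$, $i=2,3,\ldots$, satisfy the infinite linear system $$\beta_i=\gamma_{i,1}+\sum_{j=2}^\infty(-1)^j\frac{\lambda^j\beta_j}{j!}\left(\gamma_{i,1}-\gamma_{i,j}\right),\qquad i=2,3,4,\ldots,$$ and the invariant density $f$ of the stage length can be expressed in terms of the moments $\{\beta_i\}$, the density $g$, and the complementary distribution function $\overline{G}$ by the series $$f(y)=g(y)\left[1+\sum_{k=2}^\infty(-1)^k\frac{\lambda^k\beta_k}{k!}\left(1-k\,\overline{G}(y)^{k-1}\right)\right].$$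
   Context: The chain with transition density $q$ is the chain of successive stage lengths in the gated $M/G/\infty$ queue with Poisson arrivals of rate $\lambda$ and i.i.d. service times $\sigma_i$: at each gate opening all waiting customers are admitted and served in parallel, and the gate opens again when all of them have finished (or, if nobody arrived meanwhile, at the next arrival). When the service time distribution has a density and finite moments of all orders, this chain has a unique stationary probability measure; it has a density $f$ with respect to Lebesgue measure satisfying $f(y)=\int_0^\infty f(x)q(x,y)\,dx$, and it has finite moments of all orders.
   Formalization: The series need not converge under finite moments alone (exponential(μ) service with λ ≥ μ diverges), so each equation of the linear system, and the formula for f at each y, is proved under the condition that its own series converges; convergence is not asserted. *)

(* Defs.v *)
From HB Require Import structures.
From mathcomp Require Export all_boot all_order all_algebra.
From mathcomp Require Export all_classical all_reals all_analysis.

Set Implicit Arguments.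
Unset Strict Implicit.
Unset Printing Implicit Defensive.

Import Order.TTheory GRing.Theory Num.Theory.
Import numFieldNormedType.Exports.

Local Open Scope classical_set_scope.
Local Open Scope ring_scope.

Definition half_line (R : realType) : set R := `[0, +oo[.
Arguments half_line R : clear implicits.

Definition mutually_independent d (T : measurableType d) (R : realType)
    (P : probability T R) (sigma : nat -> {RV P >-> R}) : Prop :=
  forall (s : seq nat) (A : nat -> set R), uniq s ->
    (forall i, measurable (A i)) ->
    P (\bigcap_(i in [set` s]) (sigma i @^-1` A i)) =
    (\prod_(i <- s) P (sigma i @^-1` A i))%E.
Arguments mutually_independent {d T R} P sigma.

Definition has_density d (T : measurableType d) (R : realType)
    (P : probability T R) (X : {RV P >-> R}) (g : R -> R) : Prop :=
  [/\ measurable_fun setT g,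
      forall y, 0 <= g y &
      forall A : set R, measurable A ->
        distribution P X A = (\int[lebesgue_measure]_(y in A) (g y)%:E)%E].
Arguments has_density {d T R} P X g.

(* [sigma n] is the service time usually written sigma_{n+1}. *)
Definition service_times d (T : measurableType d) (R : realType)
    (P : probability T R) (sigma : nat -> {RV P >-> R}) (g : R -> R) : Prop :=
  [/\ mutually_independent P sigma,
      forall n, {ae P, forall w, 0 < sigma n w},
      forall n, has_density P (sigma n) g &
      forall n k : nat, P.-integrable setT (fun w => (sigma n w ^+ k)%:E)].
Arguments service_times {d T R} P sigma g.

Definition Gbar d (T : measurableType d) (R : realType)
    (P : probability T R) (sigma : nat -> {RV P >-> R}) (y : R) : R :=
  1 - fine (cdf (sigma 0%N) y).
Arguments Gbar {d T R} P sigma y.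

(* E[min(sigma_1, ..., sigma_k)^m] for k >= 1; the default value of the
   iterated minimum is itself one of its k arguments. *)
Definition gamma d (T : measurableType d) (R : realType)
    (P : probability T R) (sigma : nat -> {RV P >-> R}) (m k : nat) : R :=
  fine ('E_P[fun w => ((\big[Num.min/sigma 0%N w]_(i < k) sigma i w) ^+ m)%R])%E.
Arguments gamma {d T R} P sigma m k.

Definition stage_density (R : realType) (lambda : R) (H g : R -> R)
    (x y : R) : R :=
  (lambda * x * expR (- (lambda * x * H y)) + expR (- (lambda * x))) * g y.

Definition stationary (R : realType) (q : R -> R -> R)
    (nu : probability (measurableTypeR R) R) : Prop :=
  nu (half_line R) = 1%E /\
  forall A : set R, measurable A ->
    nu A = (\int[nu]_(x in half_line R)
              \int[lebesgue_measure]_(y in A `&` half_line R) (q x y)%:E)%E.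

(* [f] is a density of a stationary distribution of the chain on [0, +oo[ with
   transition density [q].  The last clause selects, among the versions of
   that density, the one solving the invariance equation at every point
   rather than almost everywhere. *)
Definition invariant_density (R : realType) (q : R -> R -> R) (f : R -> R)
    : Prop :=
  exists nu : probability (measurableTypeR R) R,
  [/\ stationary q nu,
      measurable_fun (half_line R) f,
      forall y, 0 <= y -> 0 <= f y,
      forall A : set R, measurable A ->
        nu A = (\int[lebesgue_measure]_(y in A `&` half_line R) (f y)%:E)%E &
      forall y, 0 <= y ->
        (f y)%:E = (\int[lebesgue_measure]_(x in half_line R)
                      (f x * q x y)%:E)%E].

Definition moment (R : realType) (f : R -> R) (k : nat) : R :=
  fine (\int[lebesgue_measure]_(x in half_line R) (x ^+ k * f x)%:E)%E.

(* Main.v *)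
(** With [a_k = (-lambda)^k beta_k / k!], both series have the form
    [sum_k a_k c_k]: for the density [c_k = 1 - k Gbar(y)^(k-1)], and for the
    linear system [c_k] is the integral of that same expression against
    [y^i g(y) dy], because the minimum of [k] service times has density
    [k Gbar^(k-1) g].  The invariance equation says that [f(y) / g(y)]
    and [beta_i] are the integrals of [psi(lambda x)] against [f], where
    [psi(s) = sum_k (-s)^k c_k / k!] is the integral of the kernel
    [e^(-s) + s e^(-s Gbar(y))].  Convergence of [sum_k a_k c_k] bounds its
    terms, so that for [r < 1] the sum of [a_k c_k r^k] may be computed under the
    integral, with value the integral of [f(x) psi(r lambda x)].  As [r] tends to
    1, Abel's theorem gives the limit of the sums, and dominated convergence,
    with [psi(s) = O(1 + s)], the limit of the integrals.

    Moments of [f] exist because the [k]-th moment of a transition from [x] is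
    [O(1 + x)], hence at most [C + x^k / 2] when [k >= 2]; the resulting drift
    inequality is integrated after truncation. *)

From HB Require Import structures.
From mathcomp Require Import measurable_realfun ring lra.
Require Import Defs.

Set Implicit Arguments.
Unset Strict Implicit.
Unset Printing Implicit Defensive.

Import Order.TTheory GRing.Theory Num.Theory.
Import numFieldNormedType.Exports.

Local Open Scope classical_set_scope.
Local Open Scope ring_scope.

(** * Abel's theorem and termwise integration *)

(** Summation by parts, centred at [s] so that every partial sum enters through its distance to the
    intended limit. As [series u n] stops before index [n], the sum that includes term [k] is
    [series u k.+1]. *)
Lemma abel_summation (R : realType) (u : R^nat) (s r : R) (n : nat) :
  series (fun k => u k * r ^+ k) n - s =
  (1 - r) * (\sum_(0 <= k < n) (series u k.+1 - s) * r ^+ k)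
  + (series u n - s) * r ^+ n.
Proof.
elim: n => [|n IH].
  by rewrite /series/= !big_geq// mulr0 expr0 mulr1 !add0r.
rewrite [LHS](_ : _ = series (fun k => u k * r ^+ k) n - s + u n * r ^+ n);
  last by rewrite /series/= big_nat_recr//= addrAC.
rewrite IH big_nat_recr//= exprS.
have -> : series u n.+1 = series u n + u n by rewrite /series/= big_nat_recr.
by ring.
Qed.

(** In the summation by parts, the finitely many terms below [N] are killed by the factor [1 - r];
    those beyond [N] and the boundary term are small because the partial sums are close to [s]. *)
Lemma abel_limit (R : realType) (u : R^nat) (s : R) (L : R -> R) :
  series u @ \oo --> s ->
  (forall r, 0 <= r -> r < 1 ->
    series (fun k => u k * r ^+ k) @ \oo --> L r) ->
  L r @[r --> 1^'-] --> s.
Proof.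
move=> us Lr; apply/cvgrPdist_le => e e0.
have e3 : 0 < e / 3 by rewrite divr_gt0.
have [N _ HN] : \forall n \near \oo, `|s - series u n| <= e / 3.
  by move/cvgrPdist_le : us => /(_ _ e3).
pose K := \sum_(0 <= k < N) `|series u k.+1 - s|.
have K0 : 0 <= K by exact: sumr_ge0.
near=> r.
have r0 : 0 <= r by near: r; apply: nbhs_left_ge.
have r1 : r < 1 by near: r; exact: nbhs_left_lt.
have rK : (1 - r) * K <= e / 3.
  (* [K] may be zero, hence the denominator [K + 1]. *)
  have : 1 - (e / 3) / (K + 1) <= r.
    near: r; apply: nbhs_left_ge.
    by rewrite ltrBlDr ltrDl divr_gt0// ltr_wpDl.
  rewrite lerBlDr -lerBlDl ler_pdivlMr; last by rewrite ltr_wpDl.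
  by apply: le_trans; rewrite ler_wpM2l ?subr_ge0 ?(ltW r1)// lerDl.
(* The bound is uniform in [n] for fixed [r], so it survives the passage to the limit [L r]. *)
have bnd n : (N <= n)%N ->
    `|s - series (fun k => u k * r ^+ k) n| <= e.
  move=> Nn; rewrite distrC abel_summation.
  have rn k : r ^+ k <= 1 by rewrite exprn_ile1// ltW.
  have r1' : 0 <= 1 - r by rewrite subr_ge0 ltW.
  have t1 : `|(series u n - s) * r ^+ n| <= e / 3.
    rewrite normrM distrC (ger0_norm (exprn_ge0 _ r0)).
    by rewrite -[leRHS]mulr1 ler_pM// ?exprn_ge0//; exact: HN.
  have t2 : (1 - r) * `|\sum_(0 <= k < N) (series u k.+1 - s) * r ^+ k|
      <= e / 3.
    apply: le_trans rK; rewrite ler_wpM2l//.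
    apply: le_trans (ler_norm_sum _ _ _) _; apply: ler_sum => k _.
    rewrite normrM (ger0_norm (exprn_ge0 _ r0)).
    by rewrite ler_piMr.
  have t3 : (1 - r) * `|\sum_(N <= k < n) (series u k.+1 - s) * r ^+ k|
      <= e / 3.
    (* The geometric weights have total mass at most one after multiplication by [1 - r]. *)
    have S1 : (1 - r) * (\sum_(N <= k < n) r ^+ k) <= 1.
      apply: (@le_trans _ _ ((1 - r) * \sum_(0 <= k < n) r ^+ k)).
        rewrite ler_wpM2l// (big_cat_nat (leq0n N) Nn)//= lerDr.
        by apply: sumr_ge0 => k _; exact: exprn_ge0.
      rewrite big_mkord -opprB mulNr -subrX1 opprB lerBlDr lerDl.
      exact: exprn_ge0.
    apply: (@le_trans _ _ ((1 - r) * (\sum_(N <= k < n) r ^+ k) * (e / 3))).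
      rewrite -mulrA ler_wpM2l//; apply: le_trans (ler_norm_sum _ _ _) _.
      rewrite mulr_suml; apply: ler_sum_nat => k /andP[Nk _].
      rewrite normrM (ger0_norm (exprn_ge0 _ r0)) mulrC ler_wpM2l ?exprn_ge0//.
      by rewrite distrC; apply: HN => /=; rewrite (leq_trans Nk).
    by rewrite ler_piMl// ltW.
  rewrite (big_cat_nat (leq0n N) Nn)//= mulrDr.
  have -> : e = e / 3 + e / 3 + e / 3 by field.
  apply: le_trans (ler_normD _ _) _; rewrite lerD//.
  apply: le_trans (ler_normD _ _) _.
  by rewrite !normrM (ger0_norm r1') lerD.
have /cvgrPdist_le Lr' := Lr _ r0 r1.
apply/ler_addgt0Pr => d d0.
have [M _ HM] := Lr' _ d0.
apply: le_trans (ler_distD (series (fun k => u k * r ^+ k) (maxn N M)) _ _) _.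
rewrite lerD//.
  by apply: bnd; rewrite leq_maxl.
by rewrite distrC; apply: HM => /=; rewrite leq_maxr.
Unshelve. all: by end_near. Qed.

(** Turns the left limit at 1 into a limit along a sequence, as dominated convergence requires. *)
Lemma cvg_at_left1_seq (R : realType) :
  (1 - n.+1%:R^-1 : R) @[n --> \oo] --> (1 : R)^'-.
Proof.
move=> A [e /= e0 eA].
have : (n.+1%:R^-1 : R) @[n --> \oo] --> 0 by exact: cvg_harmonic.
move/cvgrPdist_lt => /(_ _ e0); apply: filterS => n /=.
rewrite sub0r normrN => ne; apply: eA.
  by rewrite /ball_/= opprB addrCA subrr addr0.
by rewrite ltrBlDr ltrDl invr_gt0.
Qed.

Section termwise.
Context d (T : measurableType d) (R : realType).
Variables (mu : {measure set T -> \bar R}) (D : set T) (mD : measurable D).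
Variables (u : nat -> T -> R) (U : T -> R).
Hypothesis iu : forall k, mu.-integrable D (EFin \o u k).
Hypothesis su : cvgn (series (fun k => \int[mu]_(x in D) `|u k x|)).
Hypothesis uU : forall x, D x -> series (u ^~ x) @ \oo --> U x.

(** Dominated convergence for the partial sums; their majorant, the sum of the absolute values, is
    integrable by [su]. *)
Lemma termwise_Rintegral : mu.-integrable D (EFin \o U) /\
  series (fun k => \int[mu]_(x in D) u k x) @ \oo --> \int[mu]_(x in D) U x.
Proof.
have mu_ k : measurable_fun D (EFin \o u k) by exact: (measurable_int mu).
have iau k : mu.-integrable D (EFin \o (fun x => `|u k x|)).
  exact: (integrable_abse (iu k)).
(* [G] is extended-real valued: the integrals converge absolutely, but at a given point the series
   may converge only conditionally. *)
pose G x := (\sum_(0 <= k <oo) (`|u k x|)%:E)%E.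
have mG : measurable_fun D G.
  apply: ge0_emeasurable_sum => // k.
  by move=> _; exact: (measurable_int mu (iau k)).
have G0 x : D x -> (0 <= G x)%E by move=> _; exact: nneseries_ge0.
have iG : mu.-integrable D G.
  apply/integrableP; split => //.
  rewrite (eq_integral G); last by move=> x /set_mem Dx; rewrite gee0_abs ?G0.
  rewrite integral_nneseries//; last first.
    by move=> k; exact: (measurable_int mu (iau k)).
  rewrite (_ : (\sum_(_ <= _ <oo) _)%E =
      limn (EFin \o series (fun k => \int[mu]_(x in D) `|u k x|))).
    by rewrite EFin_lim// ltry.
  congr (limn _); apply/funext => n /=.
  rewrite /series/= -sumEFin; apply: eq_bigr => k _.
  rewrite /Rintegral fineK//; apply: integrable_fin_num => //; exact: iau.
pose S n x := (series (u ^~ x) n)%:E.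
have ES n x : S n x = (\sum_(0 <= k < n) (u k x)%:E)%E.
  by rewrite /S /series/= sumEFin.
have mS n : measurable_fun D (S n).
  rewrite (_ : S n = fun x => \sum_(0 <= k < n) (u k x)%:E)%E.
    by apply: emeasurable_sum => k; exact: mu_.
  by apply/funext => x; rewrite ES.
have SU x : D x -> S ^~ x @ \oo --> (U x)%:E.
  by move=> Dx; apply: cvg_EFin; [exact: nearW|exact: uU].
have mU : measurable_fun D (EFin \o U).
  exact: (emeasurable_fun_cvg S).
have SG n x : D x -> (`|S n x| <= G x)%E.
  move=> Dx; rewrite ES; apply: le_trans (lee_abs_sum _ _ _) _.
  by apply: nneseries_lim_ge.
have [iU _ cU] := @dominated_convergence _ _ _ mu D mD S (EFin \o U) G mS mU
  (aeW mu SU) iG (aeW mu (fun x n => @SG n x)).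
split=> //.
have fU : (\int[mu]_(x in D) (EFin \o U) x)%E \is a fin_num.
  exact: integrable_fin_num.
have : (\int[mu]_(x in D) S n x)%E @[n --> \oo] --> (\int[mu]_(x in D) U x)%:E.
  by rewrite fineK.
move/fine_cvg.
apply: cvg_trans; apply: near_eq_cvg; apply: nearW => n /=.
rewrite [in RHS]/series/=.
under eq_integral do rewrite ES.
rewrite integral_sum//= -sum_fine//.
  by move=> k _; apply: integrable_fin_num => //; exact: iu.
Qed.

End termwise.

(** * The kernel as a power series, and its termwise integral *)

Lemma cvg_series_expR (R : realType) (x : R) :
  series (exp_coeff x) @ \oo --> expR x.
Proof. exact: is_cvg_series_exp_coeff. Qed.

(** Since [k / k! = 1 / (k-1)!], the terms with [k h^(k-1)] form [s] times the exponential series at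
    [- s h], shifted by one index. At [k = 0] the factor [k] removes that term. *)
Lemma cvg_series_min_kernel (R : realType) (s h : R) :
  series (fun k => (- s) ^+ k / k`!%:R * (1 - k%:R * h ^+ k.-1)) @ \oo -->
  expR (- s) + s * expR (- (s * h)).
Proof.
rewrite -cvg_shiftS /=.
have -> : (fun n => series (fun k => (- s) ^+ k / k`!%:R *
      (1 - k%:R * h ^+ k.-1)) n.+1) =
    (fun n => series (exp_coeff (- s)) n.+1 +
      s * series (exp_coeff (- (s * h))) n).
  apply/funext => n; elim: n => [|n IH].
    rewrite /series/= !big_nat1 big_geq// /exp_coeff/=.
    by rewrite !expr0 fact0; field.
  rewrite /series/= in IH *.
  rewrite big_nat_recr//= IH [in RHS]big_nat_recr//=.
  rewrite [X in _ = _ + s * X]big_nat_recr//= /exp_coeff/=.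
  rewrite factS natrM -mulNr (exprMn _ (- s)) (exprS (- s)).
  have f0 : n`!%:R != 0 :> R by rewrite pnatr_eq0 -lt0n fact_gt0.
  have n0 : n.+1%:R != 0 :> R by rewrite pnatr_eq0.
  by field; rewrite f0 addrC natr1 n0.
apply: cvgD; first by rewrite cvg_shiftS; exact: cvg_series_expR.
by apply: cvgMr; exact: cvg_series_expR.
Qed.

(** The crude bound [1 + k <= 2^k] is enough: against [s^k / k!] it only replaces [s] by [2 s]. *)
Lemma normr_min_coeff (R : realType) (h : R) (k : nat) :
  0 <= h -> h <= 1 -> `|1 - k%:R * h ^+ k.-1| <= 2 ^+ k.
Proof.
move=> h0 h1; apply: le_trans (ler_normB _ _) _.
rewrite normr1 normrM normrX (ger0_norm h0) (ger0_norm (ler0n _ _)).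
apply: (@le_trans _ _ k.+1%:R).
  by rewrite -natr1 addrC lerD2r ler_piMr// exprn_ile1.
by rewrite -natrX ler_nat ltn_expl.
Qed.

Lemma integrable_scale d (T : measurableType d) (R : realType)
    (mu : {measure set T -> \bar R}) (D : set T) (r : R) (f : T -> R) :
  measurable D -> mu.-integrable D (EFin \o f) ->
  mu.-integrable D (EFin \o (fun x => r * f x)).
Proof. by move=> mD; exact: integrableZl. Qed.

Lemma integrable_mul_bounded d (T : measurableType d) (R : realType)
    (mu : {measure set T -> \bar R}) (D : set T) (w phi : T -> R) (C : R) :
  measurable D -> mu.-integrable D (EFin \o w) -> measurable_fun D phi ->
  (forall x, D x -> `|phi x| <= C) ->
  mu.-integrable D (EFin \o (fun x => w x * phi x)).
Proof.
move=> mD iw mphi phiC.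
have mw : measurable_fun D w.
  by apply/measurable_EFinP; exact: (measurable_int mu iw).
apply: (@le_integrable _ _ _ mu D mD _ (EFin \o (fun x => C * w x))).
- by apply/measurable_EFinP; exact: measurable_funM.
- move=> x Dx; rewrite /= lee_fin !normrM mulrC ler_wpM2r//.
  by rewrite (le_trans (phiC _ Dx))// ler_norm.
- exact: integrable_scale.
Qed.

Section min_kernel.
Context d (T : measurableType d) (R : realType).
Variables (mu : {measure set T -> \bar R}) (D : set T) (mD : measurable D).
Variables (w h : T -> R).
Hypothesis w0 : forall x, D x -> 0 <= w x.
Hypothesis iw : mu.-integrable D (EFin \o w).
Hypothesis mh : measurable_fun D h.
Hypothesis h01 : forall x, D x -> 0 <= h x <= 1.

Lemma integrable_min_coeff (k : nat) :
  mu.-integrable D (EFin \o (fun x => w x * (1 - k%:R * h x ^+ k.-1))).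
Proof.
apply: (@integrable_mul_bounded _ _ _ _ _ _ _ (2 ^+ k)) => //.
  apply: measurable_funB => //; apply: measurable_funM => //.
  exact: measurable_funX.
by move=> x /h01/andP[? ?]; exact: normr_min_coeff.
Qed.

(** The [k]-th term has absolute integral at most [(2 s)^k / k!] times the integral of [w], which is
    summable, so sum and integral may be exchanged. *)
Lemma min_kernel_series (s : R) : 0 <= s ->
  mu.-integrable D
    (EFin \o (fun x => w x * (expR (- s) + s * expR (- (s * h x))))) /\
  series (fun k => (- s) ^+ k / k`!%:R *
    \int[mu]_(x in D) (w x * (1 - k%:R * h x ^+ k.-1))) @ \oo -->
  \int[mu]_(x in D) (w x * (expR (- s) + s * expR (- (s * h x)))).
Proof.
move=> s0.
pose u k x := (- s) ^+ k / k`!%:R * (w x * (1 - k%:R * h x ^+ k.-1)).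
have iu k : mu.-integrable D (EFin \o u k).
  by apply: integrable_scale => //; exact: integrable_min_coeff.
have eu k : \int[mu]_(x in D) u k x = (- s) ^+ k / k`!%:R *
    \int[mu]_(x in D) (w x * (1 - k%:R * h x ^+ k.-1)).
  by rewrite /u RintegralZl//; exact: integrable_min_coeff.
have W0 : 0 <= \int[mu]_(x in D) w x by exact: Rintegral_ge0.
have bu k : \int[mu]_(x in D) `|u k x| <=
    (\int[mu]_(x in D) w x) * exp_coeff (s * 2) k.
  rewrite -RintegralZr//; apply: le_Rintegral => //.
  - exact: (integrable_abse (iu k)).
  - under eq_fun do rewrite mulrC; exact: integrable_scale.
  - move=> x Dx; rewrite /u !normrM normrX normrN normfV (ger0_norm s0).
    rewrite (ger0_norm (ler0n _ _)) (ger0_norm (w0 Dx)) mulrCA ler_wpM2l ?w0//.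
    rewrite /exp_coeff/= exprMn mulrAC ler_wpM2r ?invr_ge0//.
    rewrite ler_wpM2l ?exprn_ge0//.
    by have /andP[? ?] := h01 Dx; exact: normr_min_coeff.
have su : cvgn (series (fun k => \int[mu]_(x in D) `|u k x|)).
  apply: (series_le_cvg _ _ bu).
  - by move=> k; exact: Rintegral_ge0.
  - by move=> k; rewrite mulr_ge0// exp_coeff_ge0// mulr_ge0.
  - rewrite (_ : series _ = (fun n =>
      (\int[mu]_(x in D) w x) * series (exp_coeff (s * 2)) n)).
      by apply: is_cvgMr; exact: is_cvg_series_exp_coeff.
    by apply/funext => n; rewrite /series/= mulr_sumr.
have uU x : D x -> series (u ^~ x) @ \oo -->
    w x * (expR (- s) + s * expR (- (s * h x))).
  move=> Dx; rewrite (_ : series _ = (fun n => w x *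
      series (fun k => (- s) ^+ k / k`!%:R * (1 - k%:R * h x ^+ k.-1)) n)).
    by apply: cvgMr; exact: cvg_series_min_kernel.
  apply/funext => n; rewrite /series/= mulr_sumr; apply: eq_bigr => k _.
  by rewrite /u mulrCA.
have [iU cU] := termwise_Rintegral mD iu su uU; split=> //.
by rewrite -(funext eu).
Qed.

End min_kernel.

(** * Abel summation under the integral sign *)

Section abel_integral.
Context d (T : measurableType d) (R : realType).
Variables (mu : {measure set T -> \bar R}) (D : set T) (mD : measurable D).
Variables (w t : T -> R) (c : R^nat) (psi : R -> R) (C S : R).
Hypothesis w0 : forall x, D x -> 0 <= w x.
Hypothesis t0 : forall x, D x -> 0 <= t x.
Hypothesis iwt : forall k, mu.-integrable D (EFin \o (fun x => w x * t x ^+ k)).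
Hypothesis psiE : forall s, 0 <= s ->
  series (fun k => (- s) ^+ k / k`!%:R * c k) @ \oo --> psi s.
Hypothesis psi_le : forall s, 0 <= s -> `|psi s| <= C * (1 + s).

Let b k := (-1) ^+ k / k`!%:R * c k * \int[mu]_(x in D) (w x * t x ^+ k).
Hypothesis bS : series b @ \oo --> S.

(* Only [b] is assumed summable: its boundedness replaces any growth condition
   on [c] in the absolute convergence for [r < 1]. *)
Let bounded_b : exists M, forall k, `|b k| <= M.
Proof.
have : b @ \oo --> 0 by apply: cvg_series_cvg_0; apply/cvg_ex; exists S.
move=> /cvgP/cvg_seq_bounded[M [_ HM]]; exists (M + 1) => k.
by apply: HM => //; rewrite ltrDl.
Qed.

(** As [w * t ^+ k] is nonnegative, the [k]-th term has absolute integral exactly [|b k| r^k],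
    dominated by a geometric series once [b] is bounded. *)
Let damped r : 0 <= r -> r < 1 ->
  mu.-integrable D (EFin \o (fun x => w x * psi (r * t x))) /\
  series (fun k => b k * r ^+ k) @ \oo -->
    \int[mu]_(x in D) (w x * psi (r * t x)).
Proof.
move=> r0 r1.
pose u k x := w x * t x ^+ k * ((- r) ^+ k / k`!%:R * c k).
have iu k : mu.-integrable D (EFin \o u k).
  by rewrite /u; under eq_fun do rewrite mulrC; exact: integrable_scale.
have eu k : \int[mu]_(x in D) u k x = b k * r ^+ k.
  rewrite /u RintegralZr// /b (_ : - r = -1 * r) ?mulN1r// -mulN1r exprMn.
  by field; rewrite pnatr_eq0 -lt0n fact_gt0.
have eau k : \int[mu]_(x in D) `|u k x| = `|b k| * r ^+ k.
  rewrite (@eq_Rintegral _ _ _ mu D (fun x => w x * t x ^+ k *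
      `|(- r) ^+ k / k`!%:R * c k|)); last first.
    move=> x /set_mem Dx; rewrite /u normrM ger0_norm// mulr_ge0 ?w0//.
    by rewrite exprn_ge0// t0.
  rewrite RintegralZr// /b !normrM !normrX !normrN normr1 expr1n.
  rewrite (ger0_norm r0) [X in _ = _ * _ * X * _]ger0_norm; first by ring.
  by apply: Rintegral_ge0 => x Dx; rewrite mulr_ge0 ?w0// exprn_ge0// t0.
have su : cvgn (series (fun k => \int[mu]_(x in D) `|u k x|)).
  have [M HM] := bounded_b.
  have M0 : 0 <= M by apply: le_trans (HM 0%N).
  apply: (@series_le_cvg _ _ (geometric M r)).
  - by move=> k; exact: Rintegral_ge0.
  - by move=> k; rewrite mulr_ge0// exprn_ge0.
  - by move=> k; rewrite eau ler_wpM2r// exprn_ge0.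
  - by apply: is_cvg_geometric_series; rewrite ger0_norm.
have uU x : D x -> series (u ^~ x) @ \oo --> w x * psi (r * t x).
  move=> Dx; rewrite (_ : series _ = (fun n => w x *
      series (fun k => (- (r * t x)) ^+ k / k`!%:R * c k) n)).
    by apply: cvgMr; apply: psiE; rewrite mulr_ge0// t0.
  apply/funext => n; rewrite /series/= mulr_sumr; apply: eq_bigr => k _.
  by rewrite /u -mulNr exprMn; ring.
have [iU cU] := termwise_Rintegral mD iu su uU; split=> //.
by rewrite -(funext eu).
Qed.

Lemma Rintegral_abel_sum :
  mu.-integrable D (EFin \o (fun x => w x * psi (t x))) /\
  \int[mu]_(x in D) (w x * psi (t x)) = S.
Proof.
pose r n : R := 1 - n.+1%:R^-1.
have r0 n : 0 <= r n by rewrite subr_ge0 invf_le1// ler1n.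
have r1 n : r n < 1 by rewrite ltrBlDr ltrDl invr_gt0.
have cr : r n @[n --> \oo] --> (1 : R)^'- by exact: cvg_at_left1_seq.
pose F n x := (w x * psi (r n * t x))%:E.
have mF n : measurable_fun D (F n).
  by have [iF _] := damped (r0 n) (r1 n); exact: (measurable_int mu iF).
have FU x : D x -> F ^~ x @ \oo --> (w x * psi (t x))%:E.
  move=> Dx; apply: cvg_EFin; first exact: nearW.
  apply: cvgMr.
  (* Abel's theorem for the power series of [psi] at the point [t x] takes the place of continuity
     of [psi]. *)
  have A : psi (y * t x) @[y --> 1^'-] --> psi (t x).
    apply: (abel_limit (psiE (t0 Dx))) => y y0 y1.
    rewrite (_ : (fun k => _) =
        (fun k => (- (y * t x)) ^+ k / k`!%:R * c k)).
      by apply: psiE; rewrite mulr_ge0// t0.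
    by apply/funext => k; rewrite -mulrN exprMn; ring.
  exact: (cvg_comp _ _ cr A).
(* The majorant needs only the moments of order 0 and 1. *)
have iG : mu.-integrable D (EFin \o (fun x => C * (w x * (1 + t x)))).
  apply: integrable_scale => //.
  have -> : (fun x => w x * (1 + t x)) =
      (fun x => w x * t x ^+ 0 + w x * t x ^+ 1).
    by apply/funext => x; rewrite expr0 expr1 mulrDr.
  exact: (integrableD mD (iwt 0) (iwt 1)).
have FG n x : D x -> (`|F n x| <= (C * (w x * (1 + t x)))%:E)%E.
  move=> Dx; rewrite lee_fin normrM (ger0_norm (w0 Dx)) mulrCA.
  rewrite ler_wpM2l ?w0//; apply: le_trans (psi_le _) _.
    by rewrite mulr_ge0// t0.
  (* The growth bound at [s = 0] gives the sign of [C]. *)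
  have C0 : 0 <= C.
    by have := le_trans (normr_ge0 _) (psi_le (lexx 0)); rewrite addr0 mulr1.
  by rewrite ler_wpM2l// lerD2l ler_piMl ?t0// ltW.
have [iU _ cU] := @dominated_convergence _ _ _ mu D mD F
  (EFin \o (fun x => w x * psi (t x))) _ mF (emeasurable_fun_cvg _ _ mF FU)
  (aeW mu FU) iG (aeW mu (fun x n => @FG n x)).
split=> //.
have {}cU : (\int[mu]_(x in D) F n x)%E @[n --> \oo] -->
    (\int[mu]_(x in D) (w x * psi (t x)))%:E.
  by rewrite fineK//; exact: integrable_fin_num.
move/fine_cvg : cU => cU.
have A := abel_limit bS (fun y y0 y1 => (damped y0 y1).2).
have B := cvg_comp _ _ cr A.
rewrite -(cvg_lim (@Rhausdorff R) cU); exact: (cvg_lim (@Rhausdorff R) B).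
Qed.

End abel_integral.

Lemma ge0_integral_scale d (T : measurableType d) (R : realType)
    (mu : {measure set T -> \bar R}) (D : set T) (r : R) (f : T -> R) :
  measurable D -> measurable_fun D f -> (forall x, D x -> 0 <= f x) -> 0 <= r ->
  (\int[mu]_(x in D) (r * f x)%:E = r%:E * \int[mu]_(x in D) (f x)%:E)%E.
Proof.
move=> mD mf f0 r0; under eq_integral do rewrite EFinM.
by rewrite ge0_integralZl//; exact/measurable_EFinP.
Qed.

(** * Densities and tails *)

Section tonelli_setX.
Context d1 d2 (T1 : measurableType d1) (T2 : measurableType d2) (R : realType).
Variables (m1 : {sigma_finite_measure set T1 -> \bar R})
  (m2 : {sigma_finite_measure set T2 -> \bar R}).

(** Tonelli's theorem for the extension of [f] by zero outside the rectangle. *)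
Lemma tonelli_setX (D1 : set T1) (D2 : set T2) (f : T1 * T2 -> \bar R) :
  measurable D1 -> measurable D2 -> measurable_fun (D1 `*` D2) f ->
  (forall x y, D1 x -> D2 y -> (0 <= f (x, y))%E) ->
  (\int[m1]_(x in D1) \int[m2]_(y in D2) f (x, y) =
   \int[m2]_(y in D2) \int[m1]_(x in D1) f (x, y))%E /\
  measurable_fun D1 (fun x => \int[m2]_(y in D2) f (x, y))%E.
Proof.
move=> mD1 mD2 mf f0.
have mD : measurable (D1 `*` D2) by exact: measurableX.
have mF : measurable_fun setT (f \_ (D1 `*` D2)).
  by apply/(measurable_restrictT f mD).
have F0 z : (0 <= (f \_ (D1 `*` D2)) z)%E.
  by apply: erestrict_ge0 => -[x y] [? ?]; exact: f0.
have FE x y : (f \_ (D1 `*` D2)) (x, y) =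
    (if x \in D1 then if y \in D2 then f (x, y) else 0 else 0)%E.
  by rewrite /patch in_setX/=; case: (x \in D1); case: (y \in D2).
have E1 x : (\int[m2]_y (f \_ (D1 `*` D2)) (x, y) =
    if x \in D1 then \int[m2]_(y in D2) f (x, y) else 0)%E.
  case: ifPn => xD; last by apply: integral0_eq => y _; rewrite FE (negbTE xD).
  by rewrite [RHS]integral_mkcond; apply: eq_integral => y _; rewrite FE xD.
split; last first.
  have := @measurable_fun_fubini_tonelli_F _ _ _ _ _ m2 _ mF F0.
  move=> /(measurable_funS measurableT (@subsetT _ D1)).
  by apply: eq_measurable_fun => x xD; rewrite /fubini_F E1 xD.
have := @fubini_tonelli _ _ _ _ _ m1 m2 _ mF F0.
rewrite [in X in X -> _](_ :
    (\int[m1]_x \int[m2]_y (f \_ (D1 `*` D2)) (x, y) =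
     \int[m1]_(x in D1) \int[m2]_(y in D2) f (x, y))%E); last first.
  by rewrite [RHS]integral_mkcond; apply: eq_integral => x _; rewrite E1 patchE.
move=> ->.
rewrite [RHS]integral_mkcond; apply: eq_integral => y _.
rewrite [RHS]/patch; case: ifPn => yD.
  rewrite [RHS]integral_mkcond; apply: eq_integral => x _.
  by rewrite FE yD.
by apply: integral0_eq => x _; rewrite FE (negbTE yD); case: ifP.
Qed.

End tonelli_setX.

Section tail_power.
Context (R : realType).
Local Notation mu := (@lebesgue_measure R).
Variables (g H : R -> R).
Hypothesis mg : measurable_fun setT g.
Hypothesis g0 : forall y, 0 <= g y.
Hypothesis HE : forall y, (\int[mu]_(z in `]y, +oo[) (g z)%:E = (H y)%:E)%E.

Lemma tail_ge0 y : 0 <= H y.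
Proof. by rewrite -lee_fin -HE integral_ge0// => z _; rewrite lee_fin. Qed.

(** The endpoint [w] has Lebesgue measure zero, and [H w] is real, so it can be subtracted. *)
Lemma tail_split y w : y < w ->
  (\int[mu]_(z in `]y, w[) (g z)%:E = (H y - H w)%:E)%E.
Proof.
move=> yw; have mgE D : measurable_fun D (fun z => (g z)%:E).
  by apply/measurable_EFinP; exact: measurable_funTS.
suff e : (H y)%:E = (\int[mu]_(z in `]y, w[) (g z)%:E + (H w)%:E)%E.
  by rewrite EFinB e addeK.
rewrite -!HE (@integral_itv_obnd_cbnd _ w)// -ge0_integral_setU//=.
- by rewrite -itv_bndbnd_setU//= ?bnd_simp ?ltW.
- exact: mgE.
- by move=> x _; rewrite lee_fin.
- apply/disj_setPS => x []/=; rewrite !in_itv/= => /andP[_ xw] /andP[].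
  by rewrite leNgt xw.
Qed.

Lemma tail_nonincreasing y w : y < w -> H w <= H y.
Proof.
move=> yw; rewrite -subr_ge0 -lee_fin -(tail_split yw) integral_ge0// => z _.
by rewrite lee_fin.
Qed.

Lemma measurable_tail : measurable_fun setT H.
Proof.
apply: nonincreasing_measurable => // x y.
by rewrite le_eqVlt => /predU1P[->//|]; exact: tail_nonincreasing.
Qed.

(* Tonelli on [y < x < z] gives [(k + 1) X = J (k + 1)] and
   [X + J (k + 1) = H y * J k], where [J k] is the integral of [H^k g] over
   [(y, +oo)] and [X] that of [g x * H z ^ k * g z]; no differentiability of
   the tail [H] is needed. *)
Lemma integral_tail_power k y :
  (\int[mu]_(z in `]y, +oo[) (k.+1%:R * H z ^+ k * g z)%:E =
   (H y ^+ k.+1)%:E)%E.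
Proof.
pose J k y := (\int[mu]_(z in `]y, +oo[) (H z ^+ k * g z)%:E)%E.
have mJ D j : measurable_fun D (fun z => H z ^+ j * g z).
  apply/measurable_funTS; apply: measurable_funM => //.
  by apply: measurable_funX; exact: measurable_tail.
have J0 j z : 0 <= H z ^+ j * g z.
  by rewrite mulr_ge0// exprn_ge0// tail_ge0.
suff JE : J k y = (H y ^+ k.+1 / k.+1%:R)%:E.
  rewrite (_ : H y ^+ k.+1 = k.+1%:R * (H y ^+ k.+1 / k.+1%:R)); last first.
    by rewrite mulrCA divff ?mulr1// pnatr_eq0.
  rewrite EFinM -JE -ge0_integral_scale//; last exact: mJ.
  by apply: eq_integral => z _; rewrite mulrA.
move: k y; elim=> [|k IH] y.
  rewrite expr1 divr1 -HE; apply: eq_integral => z _.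
  by rewrite expr0 mul1r.
(* The indicator of [x < z] makes the domain a square, so that the two orders of integration can be
   compared. *)
pose F (p : R * R) := ((p.1 < p.2)%R%:R *
  (g p.1 * (H p.2 ^+ k * g p.2)))%:E.
have mF : measurable_fun (`]y, +oo[ `*` `]y, +oo[) F.
  apply/measurable_EFinP/measurable_funTS.
  apply: measurable_funM.
    rewrite (_ : (fun p => _) = \1_((fun p : R * R => p.1 < p.2) @^-1` [set true])).
      apply: measurable_indic; rewrite -[X in measurable X]setTI.
      by apply: measurable_fun_ltr.
    apply/funext => p; rewrite indicE; congr (nat_of_bool _)%:R.
    by apply/idP/idP => [?|/set_mem//]; exact: mem_set.
  apply: measurable_funM; first exact: measurableT_comp.
  apply: measurable_funM; last exact: measurableT_comp.
  apply: measurable_funX; apply: measurableT_comp => //; exact: measurable_tail.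
have F0 x z : `]y, +oo[%classic x -> `]y, +oo[%classic z -> (0 <= F (x, z))%E.
  move=> _ _; rewrite lee_fin; apply: mulr_ge0; last exact: mulr_ge0.
  exact: ler0n.
have yoo x : y < x -> `]x, +oo[%classic = `]y, +oo[ `&` `]x, +oo[.
  move=> yx; apply/seteqP; split => z /=; rewrite !in_itv/= !andbT => xz.
    by rewrite (lt_trans yx).
  by case: xz.
have yz z : y < z -> `]y, z[%classic = `]y, +oo[ `&` `]-oo, z[.
  move=> yx; apply/seteqP; split => x /=; rewrite !in_itv/= !andbT.
    by move/andP.
  by move=> [-> ->].
have E1 x : y < x -> (\int[mu]_(z in `]y, +oo[) F (x, z) =
    (k.+1%:R^-1 * (H x ^+ k.+1 * g x))%:E)%E.
  move=> yx; rewrite mulrCA mulrA mulrC EFinM -IH -ge0_integral_scale//; last exact: mJ.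
  rewrite (yoo x yx) integral_mkcondr; apply: eq_integral => z _.
  rewrite /F/= /patch mem_setE/= in_itv/= andbT.
  by case: ifP => _; rewrite ?mul1r ?mul0r.
have E2 z : y < z -> (\int[mu]_(x in `]y, +oo[) F (x, z) =
    (H z ^+ k * g z * (H y - H z))%:E)%E.
  move=> yz'; rewrite EFinM -tail_split// -ge0_integral_scale//;
    last exact: measurable_funTS.
  rewrite (yz z yz') integral_mkcondr; apply: eq_integral => x _.
  rewrite /F/= /patch mem_setE/= in_itv/=.
  by case: ifP => _; rewrite ?mul1r ?mul0r// mulrC.
have [FF _] := @tonelli_setX _ _ _ _ _ mu mu _ _ _ (measurable_itv _) (measurable_itv _)
  mF F0.
have L : (\int[mu]_(x in `]y, +oo[) \int[mu]_(z in `]y, +oo[)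
    F (x, z) = k.+1%:R^-1%:E * J k.+1 y)%E.
  rewrite -ge0_integral_scale//; last exact: mJ.
  apply: eq_integral => x /set_mem/=; rewrite in_itv/= andbT => yx.
  by rewrite E1.
have Rr : (\int[mu]_(z in `]y, +oo[) \int[mu]_(x in `]y, +oo[) F (x, z)
    + J k.+1 y = (H y ^+ k.+2 / k.+1%:R)%:E)%E.
  rewrite exprS -mulrA EFinM -IH -ge0_integral_scale//; [|exact: mJ|exact: tail_ge0].
  have -> : (\int[mu]_(z in `]y, +oo[) \int[mu]_(x in `]y, +oo[) F (x, z) =
      \int[mu]_(z in `]y, +oo[) (H z ^+ k * g z * (H y - H z))%:E)%E.
    apply: eq_integral => z /set_mem/=; rewrite in_itv/= andbT; exact: E2.
  rewrite -ge0_integralD//.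
  - apply: eq_integral => z _; rewrite -EFinD; congr (_%:E).
    by rewrite exprSr; ring.
  - move=> z; rewrite /= in_itv/= andbT => /tail_nonincreasing zy.
    by rewrite lee_fin mulr_ge0 ?subr_ge0// mulr_ge0// exprn_ge0// tail_ge0.
  - apply/measurable_EFinP; apply: measurable_funM.
      exact: mJ.
    by apply: measurable_funB => //; apply: measurable_funTS; exact: measurable_tail.
  - by move=> z _; rewrite lee_fin.
  - by apply/measurable_EFinP; exact: mJ.
rewrite -FF L in Rr; move: Rr.
(* [J k.+1 y] could a priori be infinite; this is excluded because its sum with a positive multiple
   of itself is finite. *)
have : (0 <= J k.+1 y)%E by apply: integral_ge0 => z _; rewrite lee_fin.
have k1 : k.+1%:R^-1 > 0 :> R by rewrite invr_gt0.
case: (J k.+1 y) => [j _|_|//]; last by rewrite gt0_muley// lte_fin.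
rewrite -EFinM -EFinD => -[jE]; congr (_%:E).
have n0 : k.+1%:R != 0 :> R by rewrite pnatr_eq0.
have n1 : k.+1%:R + 1 != 0 :> R by rewrite natr1 pnatr_eq0.
apply: (mulIf (invr_neq0 n0)); rewrite mulrAC -jE -[k.+2%:R]natr1.
by move: n0 n1; move: (k.+1%:R : R) => a n0 n1; field; rewrite n1 n0.
Qed.

End tail_power.

(** * Measures given by a density, and their uniqueness *)

Section density_measure.
Context d (T : measurableType d) (R : realType).
Variables (mu : {measure set T -> \bar R}) (p : T -> R).
Hypothesis mp : measurable_fun setT p.
Hypothesis p0 : forall x, 0 <= p x.

Let density_measure (A : set T) : \bar R := (\int[mu]_(x in A) (p x)%:E)%E.

Let dens0 : density_measure set0 = 0%E.
Proof. exact: integral_set0. Qed.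

Let dens_ge0 A : (0 <= density_measure A)%E.
Proof. by apply: integral_ge0 => x _; rewrite lee_fin. Qed.

Let dens_sigma_additive : semi_sigma_additive density_measure.
Proof.
move=> F mF tF mUF; rewrite /density_measure ge0_integral_bigcup//=.
- by apply: is_cvg_nneseries => n _ _; exact: dens_ge0.
- by apply/measurable_EFinP; exact: measurable_funTS.
- by move=> x _; rewrite lee_fin.
Qed.

#[local] HB.instance Definition _ := isMeasure.Build _ _ _ density_measure
  dens0 dens_ge0 dens_sigma_additive.

(** Bundles the weighted measure, so that it can be compared on rays with the law of a random
    variable. *)
Lemma density_measure_exists : exists m : {measure set T -> \bar R},
  forall A, m A = (\int[mu]_(x in A) (p x)%:E)%E.
Proof. by exists density_measure. Qed.

End density_measure.

(** Rays generate the Borel sets, are stable under intersection (take the larger endpoint), and the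
    rays from [-n] exhaust the line with finite measure. *)
Lemma measure_rays_unique (R : realType)
    (m1 m2 : {measure set (measurableTypeR R) -> \bar R}) :
  (forall y, m1 `]y, +oo[%classic = m2 `]y, +oo[%classic) ->
  (forall y, (m1 `]y, +oo[%classic < +oo)%E) ->
  forall A, measurable A -> m1 A = m2 A.
Proof.
move=> m12 fin; pose G := [set B : set R | exists y, B = `]y, +oo[%classic].
move=> A mA; apply: (@measure_unique _ R (measurableTypeR R) G
  (fun n => `](- n%:R)%R, +oo[%classic)).
- exact: RGenOInfty.measurableE.
- move=> _ _ [x ->] [y ->]; exists (Num.max x y).
  apply/seteqP; split => z /=; rewrite !in_itv/= !andbT ?gt_max.
    by move=> [-> ->].
  by move=> /andP[].
- by move=> n; exists (- n%:R).
- apply/seteqP; split => // x _; exists (Num.truncn `|x|).+1 => //=.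
  rewrite in_itv/= andbT ltrNl.
  by rewrite (le_lt_trans _ (truncnS_gt _))// -normrN ler_norm.
- by move=> _ [y ->].
- by move=> n; exact: fin.
- exact: mA.
Qed.

(** [p] and the Radon-Nikodym derivative of [m] have the same integral over every measurable set,
    hence agree almost everywhere. *)
Lemma ge0_integral_of_density d (T : measurableType d) (R : realType)
    (mu : {sigma_finite_measure set T -> \bar R})
    (m : {finite_measure set T -> \bar R}) (p phi : T -> R) :
  measurable_fun setT p ->
  (forall A, measurable A -> m A = \int[mu]_(x in A) (p x)%:E)%E ->
  measurable_fun setT phi -> (forall x, 0 <= phi x) ->
  (\int[m]_x (phi x)%:E = \int[mu]_x (phi x * p x)%:E)%E.
Proof.
move=> mp mE mphi phi0.
have mmu : m `<< mu.
  apply/null_content_dominatesP => A mA A0.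
  by rewrite mE//; apply: null_set_integral => //; apply/measurable_EFinP/measurable_funTS.
have mphiE : measurable_fun setT (EFin \o phi) by exact/measurable_EFinP.
have mpE : measurable_fun setT (EFin \o p) by exact/measurable_EFinP.
have iRN := Radon_Nikodym_SigmaFinite.f_integrable mmu.
have mRN := measurable_int _ iRN.
have ae : ae_eq mu setT (Radon_Nikodym_SigmaFinite.f m mu) (EFin \o p).
  apply: integral_ae_eq => // A _ mA.
  by rewrite -Radon_Nikodym_SigmaFinite.f_integral// mE.
rewrite -(Radon_Nikodym_SigmaFinite.change_of_variables mmu)//.
apply: ae_eq_integral => //.
- exact: emeasurable_funM.
- by apply/measurable_EFinP; exact: measurable_funM.
- by apply: filterS ae => x + _ => -> //.
Qed.

(** * Minima of service times *)

(* The codomain is [measurableTypeR R], the type carrying [lebesgue_measure]; the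
   canonical structure on [R] has another display. *)
Lemma random_variable_of d (T : measurableType d) (R : realType)
    (P : probability T R) (f : T -> R) : measurable_fun setT f ->
  exists X : {RV P >-> measurableTypeR R}, X = f :> (T -> R).
Proof.
move=> mf.
have mf' : @measurable_fun _ _ T (measurableTypeR R) setT f by exact: mf.
have @X : {mfun T >-> measurableTypeR R} := HB.pack (f : T -> measurableTypeR R)
  (isMeasurableFun.Build _ _ T (measurableTypeR R) f mf').
by exists X.
Qed.

Section service.
Context (d : measure_display) (T : measurableType d) (R : realType).
Variables (P : probability T R) (sigma : nat -> {RV P >-> R}) (g : R -> R).
Hypothesis hsigma : service_times P sigma g.

Local Notation mu := (@lebesgue_measure R).
Local Notation D := (half_line R).
Local Notation H := (Gbar P sigma).

Lemma measurable_half_line : measurable D.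
Proof. exact: measurable_itv. Qed.

Lemma measurable_density : measurable_fun setT g.
Proof. by case: hsigma => _ _ /(_ 0%N)[]. Qed.

Lemma density_ge0 y : 0 <= g y.
Proof. by case: hsigma => _ _ /(_ 0%N)[]. Qed.

Lemma service_law n A : measurable A ->
  P (sigma n @^-1` A) = (\int[mu]_(y in A) (g y)%:E)%E.
Proof. by case: hsigma => _ _ /(_ n)[_ _ h] _ mA; rewrite -h. Qed.

Lemma Gbar_tail y : (\int[mu]_(z in `]y, +oo[) (g z)%:E = (H y)%:E)%E.
Proof.
rewrite -(service_law 0%N)//; rewrite /Gbar.
have -> : P (sigma 0%N @^-1` `]y, +oo[) = (1 - cdf (sigma 0%N) y)%E.
  by rewrite -ccdf_1_cdf.
by rewrite EFinB fineK// fin_num_measure.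
Qed.

Lemma Gbar0 : H 0 = 1.
Proof.
apply: EFin_inj; rewrite -Gbar_tail -(service_law 0%N)//.
set A := (X in P X).
have mA : measurable A by exact: measurable_funPTI.
have A0 : P (~` A) = 0%E.
  apply/measure_negligible; first exact: measurableC.
  case: hsigma => _ /(_ 0%N) + _ _; apply: negligibleS => w /=.
  by rewrite /A /= in_itv/= andbT.
by rewrite -[A]setCK probability_setC ?A0 ?sube0//; exact: measurableC.
Qed.

Lemma Gbar_ge0 y : 0 <= H y.
Proof. exact: tail_ge0 density_ge0 Gbar_tail _. Qed.

Lemma Gbar_le1 y : H y <= 1.
Proof.
rewrite -lee_fin -Gbar_tail -(service_law 0%N)//.
by apply: probability_le1; exact: measurable_funPTI.
Qed.

Lemma measurable_Gbar : measurable_fun setT H.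
Proof. exact: measurable_tail measurable_density density_ge0 Gbar_tail. Qed.

Definition min_service k (w : T) : R := \big[Num.min/sigma 0%N w]_(i < k) sigma i w.

Lemma measurable_min_service k : measurable_fun setT (min_service k).
Proof.
rewrite /min_service; elim: (index_enum _) => [|i s IH].
  by under eq_fun do rewrite big_nil; exact: measurable_funPT.
under eq_fun do rewrite big_cons.
by apply: measurable_minr; [exact: measurable_funPT|exact: IH].
Qed.

(** The minimum exceeds [y] exactly when every service time does; independence makes this
    probability a product. *)
Lemma min_service_tail k y : P (min_service k.+1 @^-1` `]y, +oo[) = (H y ^+ k.+1)%:E.
Proof.
have -> : min_service k.+1 @^-1` `]y, +oo[ =
    \bigcap_(i in [set` iota 0 k.+1]) (sigma i @^-1` `]y, +oo[).
  apply/seteqP; split => w /=; rewrite in_itv/= andbT /min_service.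
    move=> /bigmin_gtP[_ h] i /=.
    rewrite -[_ :: _]/(iota 0 k.+1) mem_iota add0n leq0n/= => ik.
    by rewrite in_itv/= andbT; exact: (h (Ordinal ik)).
  (* The default value of the minimum must exceed [y] too; it is [sigma 0], present in the list
     since there are [k.+1] terms. *)
  move=> h; apply/bigmin_gtP; split => [|i _].
    by have := h 0%N; rewrite /= in_itv/= andbT; apply; rewrite inE.
  have := h i; rewrite /= in_itv/= andbT; apply.
  by rewrite -[_ :: _]/(iota 0 k.+1) mem_iota ltn_ord.
have [hind _ _ _] := hsigma.
rewrite (hind _ (fun=> `]y, +oo[%classic) (iota_uniq 0 k.+1))//.
under eq_bigr do rewrite service_law// Gbar_tail.
by rewrite prodEFin big_const_seq count_predT size_iota iter_mulr_1.
Qed.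

(** Density of the minimum of [k.+1] service times, formally minus the derivative of [H ^+ k.+1]. *)
Let p k y := k.+1%:R * H y ^+ k * g y.

Let mp k : measurable_fun setT (p k).
Proof.
apply: measurable_funM; last exact: measurable_density.
by apply: measurable_funM => //; apply: measurable_funX; exact: measurable_Gbar.
Qed.

Let p0 k y : 0 <= p k y.
Proof. by rewrite mulr_ge0 ?density_ge0// mulr_ge0// exprn_ge0// Gbar_ge0. Qed.

(** Both sides are measures in [A] with the same finite value [H y ^+ k.+1] on each ray. *)
Lemma min_service_law k A : measurable A ->
  P (min_service k.+1 @^-1` A) = (\int[mu]_(y in A) (p k y)%:E)%E.
Proof.
have [X XE] := random_variable_of P (measurable_min_service k.+1).
have [m mE] := density_measure_exists mu (mp k) (p0 k).
move=> mA; rewrite -mE -XE -[LHS]/(distribution P X A).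
apply: (@measure_rays_unique R (distribution P X) m _ _ A mA) => y.
  rewrite /= /distribution /pushforward XE min_service_tail mE.
  by rewrite (integral_tail_power measurable_density density_ge0 Gbar_tail).
by rewrite /= /distribution /pushforward XE min_service_tail ltry.
Qed.

Lemma ge0_integral_min_service k (phi : R -> R) :
  measurable_fun setT phi -> (forall y, 0 <= phi y) ->
  (\int[P]_w (phi (min_service k.+1 w))%:E = \int[mu]_y (phi y * p k y)%:E)%E.
Proof.
move=> mphi phi0.
have [X XE] := random_variable_of P (measurable_min_service k.+1).
rewrite -XE -(ge0_integral_distribution (T' := measurableTypeR R) X (f := EFin \o phi)).
- apply: (@ge0_integral_of_density _ (measurableTypeR R) R mu (distribution P X)) => //.
    exact: mp.
  by move=> A mA; rewrite -min_service_law// -XE.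
- exact/measurable_EFinP.
- by move=> y; rewrite lee_fin.
Qed.

Lemma min_service_ge0 k : {ae P, forall w, 0 <= min_service k.+1 w}.
Proof.
have mA : measurable (min_service k.+1 @^-1` `]0, +oo[).
  by rewrite -[X in measurable X]setTI; apply: measurable_min_service.
apply: (@negligibleS _ _ _ _ (~` (min_service k.+1 @^-1` `]0, +oo[))).
  by apply: subsetC => w /=; rewrite in_itv/= andbT => /ltW.
apply/negligibleP; first exact: measurableC.
by rewrite /= probability_setC// min_service_tail Gbar0 expr1n subee.
Qed.

Lemma integral_min_service_pow m k :
  (\int[P]_w (min_service k.+1 w ^+ m)%:E =
   \int[mu]_(y in D) (y ^+ m * p k y)%:E)%E.
Proof.
(* Odd powers are negative off the half line; the indicator makes the integrand nonnegative and
   changes nothing almost surely. *)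
pose phi y : R := y ^+ m * \1_D y.
have mphi : measurable_fun setT phi.
  apply: measurable_funM; first exact: measurable_funX.
  by apply: measurable_indic; exact: measurable_half_line.
have phi0 y : 0 <= phi y.
  rewrite /phi indicE; case: (boolP (y \in D)) => [/set_mem|_]; last by rewrite mulr0.
  by rewrite /half_line/= in_itv/= andbT => y0; rewrite mulr1 exprn_ge0.
transitivity (\int[P]_w (phi (min_service k.+1 w))%:E)%E.
  apply: ae_eq_integral => //.
  - apply/measurable_EFinP; apply: measurable_funX; exact: measurable_min_service.
  - apply/measurable_EFinP; apply: measurableT_comp => //; exact: measurable_min_service.
  - apply: filterS (min_service_ge0 k) => w w0 _.
    by rewrite /phi indicE mem_set ?mulr1// /half_line/= in_itv/= w0.
rewrite ge0_integral_min_service// [RHS]integral_mkcond.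
apply: eq_integral => y _; rewrite /phi patchE indicE.
by case: ifP => _; rewrite ?mulr1// mulr0 mul0r.
Qed.

Lemma gammaE m k : gamma P sigma m k.+1 =
  \int[mu]_(y in D) (y ^+ m * g y * (k.+1%:R * H y ^+ k)).
Proof.
rewrite /gamma unlock /Rintegral; congr fine.
rewrite integral_min_service_pow; apply: eq_integral => y _.
by rewrite /p mulrCA mulrC -mulrA [g y * _]mulrC mulrA.
Qed.

Lemma integrable_moment_density m :
  mu.-integrable D (EFin \o (fun y => y ^+ m * g y)).
Proof.
apply/integrableP; split.
  apply/measurable_EFinP/measurable_funTS; apply: measurable_funM.
    exact: measurable_funX.
  exact: measurable_density.
have -> : (\int[mu]_(y in D) `|(EFin \o (fun y => y ^+ m * g y)%R) y| =
    \int[P]_w (sigma 0%N w ^+ m)%:E)%E.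
  (* A single service time is the minimum of one, so its moment is the case [k = 0] of the formula
     for minima. *)
  rewrite (_ : (fun w => (sigma 0%N w ^+ m)%:E) =
    (fun w => (min_service 1 w ^+ m)%:E)).
    rewrite integral_min_service_pow; apply: eq_integral => y /set_mem.
    rewrite /half_line/= in_itv/= andbT => y0.
    by rewrite ger0_norm ?mulr_ge0 ?exprn_ge0 ?density_ge0// /p expr0 !mul1r.
  by apply/funext => w; rewrite /min_service big_ord_recl big_ord0 minxx.
case: hsigma => _ _ _ /(_ 0%N m) h.
by have := integrable_fin_num measurableT h; rewrite fin_numElt => /andP[].
Qed.

(** The two parts of the coefficient integrate to moments of one and of [k] service times. At
    [k = 0] the integral is [gamma i 1], whereas the empty minimum is [sigma 0] and the difference
    would vanish. *)
Lemma Rintegral_min_coeff i k : (0 < k)%N ->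
  \int[mu]_(y in D) (y ^+ i * g y * (1 - k%:R * H y ^+ k.-1)) =
  gamma P sigma i 1 - gamma P sigma i k.
Proof.
case: k => // k _; rewrite !gammaE.
have iw j : mu.-integrable D (EFin \o (fun y => y ^+ i * g y * (j.+1%:R * H y ^+ j))).
  apply: (integrable_mul_bounded (C := j.+1%:R)) => //.
  - exact: measurable_half_line.
  - exact: integrable_moment_density.
  - apply: measurable_funTS; apply: measurable_funM => //.
    by apply: measurable_funX; exact: measurable_Gbar.
  - move=> y _; rewrite ger0_norm ?mulr_ge0 ?exprn_ge0 ?Gbar_ge0//.
    by rewrite ler_piMr// exprn_ile1 ?Gbar_ge0 ?Gbar_le1.
rewrite -RintegralB//; last exact: measurable_half_line.
by apply: eq_Rintegral => y _; rewrite expr0 mulr1 mulrBr.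
Qed.

Lemma gamma0 k : gamma P sigma 0 k = 1.
Proof.
rewrite /gamma unlock; under eq_integral do rewrite expr0.
rewrite integral_cst// mul1e.
by rewrite -[RHS]/(fine 1%E); congr fine; exact: probability_setT.
Qed.

End service.

(** * Stationary stage length *)

Section chain.
Context (d : measure_display) (T : measurableType d) (R : realType).
Variables (P : probability T R) (sigma : nat -> {RV P >-> R}) (lambda : R) (g f : R -> R).
Hypothesis lambda_gt0 : 0 < lambda.
Hypothesis hsigma : service_times P sigma g.

Local Notation mu := (@lebesgue_measure R).
Local Notation D := (half_line R).
Local Notation H := (Gbar P sigma).
Local Notation q := (stage_density lambda H g).

Let mD : measurable D := @measurable_half_line R.

Let D_ge0 x : D x -> 0 <= x.
Proof. by rewrite /half_line/= in_itv/= andbT. Qed.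

(** For [s = lambda * x], the [i]-th moment of the stage following a stage of length [x]. *)
Definition transition_moment i s : R :=
  \int[mu]_(y in D) (y ^+ i * g y * (expR (- s) + s * expR (- (s * H y)))).

Let w0 i y : D y -> 0 <= y ^+ i * g y.
Proof. by move=> /D_ge0 y0; rewrite mulr_ge0 ?exprn_ge0// (density_ge0 hsigma). Qed.

Let iw i := integrable_moment_density hsigma i.

Let mH : measurable_fun D H.
Proof. by apply: measurable_funTS; exact: measurable_Gbar hsigma. Qed.

Let H01 y : D y -> 0 <= H y <= 1.
Proof. by rewrite (Gbar_ge0 hsigma) (Gbar_le1 hsigma). Qed.

Lemma kernel_norm_le s y : 0 <= s ->
  `|expR (- s) + s * expR (- (s * H y))| <= 1 + s.
Proof.
move=> s0; rewrite ger0_norm; last by rewrite addr_ge0 ?mulr_ge0 ?expR_ge0.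
rewrite lerD// ?expR_le1 ?oppr_le0//.
by rewrite ler_piMr// expR_le1 oppr_le0 mulr_ge0// (Gbar_ge0 hsigma).
Qed.

Lemma transition_moment_series i s : 0 <= s ->
  mu.-integrable D
    (EFin \o (fun y => y ^+ i * g y * (expR (- s) + s * expR (- (s * H y))))) /\
  series (fun k => (- s) ^+ k / k`!%:R *
    \int[mu]_(y in D) (y ^+ i * g y * (1 - k%:R * H y ^+ k.-1))) @ \oo -->
  transition_moment i s.
Proof.
move=> s0; have wi y : D y -> 0 <= y ^+ i * g y by exact: w0.
have := @min_kernel_series _ _ _ mu D mD _ _ wi (iw i) mH H01 s s0.
by rewrite /transition_moment.
Qed.

Lemma transition_momentE i x : D x ->
  (\int[mu]_(y in D) (y ^+ i * q x y)%:E = (transition_moment i (lambda * x))%:E)%E.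
Proof.
move=> /D_ge0 x0; have lx0 : 0 <= lambda * x by rewrite mulr_ge0// ltW.
rewrite /transition_moment /Rintegral fineK; last first.
  by apply: integrable_fin_num => //; exact: (transition_moment_series i lx0).1.
by apply: eq_integral => y _; rewrite /stage_density; congr (_%:E); ring.
Qed.

(** The kernel has total mass one: in the series for [i = 0] every coefficient with [k >= 1] is a
    difference of zeroth moments, hence zero, and the term [k = 0] is 1. *)
Lemma transition_mass s : 0 <= s -> transition_moment 0 s = 1.
Proof.
move=> s0; have [_ /cvg_lim <-//] := transition_moment_series 0 s0.
apply: cvg_lim => //; rewrite -cvg_shiftS /=.
rewrite (_ : (fun n => _) = cst 1); first exact: cvg_cst.
apply/funext => n /=.
rewrite /series/= big_nat_recl// big1_seq ?addr0.
  rewrite expr0 fact0 divr1 mul1r -[RHS](gamma0 sigma 1) (gammaE hsigma).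
  by apply: eq_Rintegral => y _; rewrite mul0r subr0 !expr0 !mulr1.
by move=> k _; rewrite (Rintegral_min_coeff hsigma)// !gamma0 subrr mulr0.
Qed.

Lemma transition_moment_ge0 i s : 0 <= s -> 0 <= transition_moment i s.
Proof.
move=> s0; apply: Rintegral_ge0 => y Dy.
by rewrite mulr_ge0 ?w0// addr_ge0 ?mulr_ge0 ?expR_ge0.
Qed.

Lemma transition_moment_le i s : 0 <= s ->
  transition_moment i s <= (\int[mu]_(y in D) (y ^+ i * g y)) * (1 + s).
Proof.
move=> s0; rewrite -RintegralZr//; apply: le_Rintegral => //.
- exact: (transition_moment_series i s0).1.
- by under eq_fun do rewrite mulrC; exact: integrable_scale.
- move=> y Dy; rewrite ler_wpM2l ?w0//.
  by apply: le_trans (ler_norm _) _; exact: kernel_norm_le.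
Qed.

(** * Integrated form of the invariance equation *)

Hypothesis hf : invariant_density q f.

Let mf : measurable_fun D f.
Proof. by case: hf => nu []. Qed.

Let f0 x : D x -> 0 <= f x.
Proof. by move=> /D_ge0; case: hf => nu [_ _ + _ _]; apply. Qed.

Let f_mass : (\int[mu]_(x in D) (f x)%:E = 1)%E.
Proof.
case: hf => nu [_ _ _ h _].
by have := h setT measurableT; rewrite probability_setT setTI => ->.
Qed.

Let fE y : D y -> (f y)%:E = (\int[mu]_(x in D) (f x * q x y)%:E)%E.
Proof. by move=> /D_ge0; case: hf => nu [_ _ _ _]; apply. Qed.

Lemma stage_density_ge0 x y : D x -> 0 <= q x y.
Proof.
move=> /D_ge0 x0; rewrite mulr_ge0 ?(density_ge0 hsigma)//.
by rewrite addr_ge0 ?mulr_ge0 ?expR_ge0// ltW.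
Qed.

Lemma measurable_stage_density :
  measurable_fun setT (fun z : R * R => q z.1 z.2).
Proof.
have m1 : measurable_fun setT (fun z : R * R => lambda * z.1).
  exact: measurable_funM.
apply: measurable_funM; last first.
  by apply: measurableT_comp => //; exact: measurable_density hsigma.
apply: measurable_funD; last first.
  by apply: measurableT_comp => //; exact: measurableT_comp.
apply: measurable_funM => //; apply: measurableT_comp => //.
apply: measurableT_comp => //; apply: measurable_funM => //.
by apply: measurableT_comp => //; exact: measurable_Gbar hsigma.
Qed.

(** [f x] times the expectation of [V] after one transition from [x], kept extended-real because no
    finiteness is known yet. *)
Let flow (V : R -> R) x := (\int[mu]_(y in D) (f x * (V y * q x y))%:E)%E.

Let measurable_q x : measurable_fun D (q x).
Proof.
apply: measurable_funTS.
have mpair : measurable_fun setT (fun y : R => (x, y)) by exact: measurable_fun_pair.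
exact: (measurableT_comp measurable_stage_density mpair).
Qed.

Let measurable_q1 y : measurable_fun D (q ^~ y).
Proof.
apply: measurable_funTS.
have mpair : measurable_fun setT (fun x : R => (x, y)) by exact: measurable_fun_pair.
exact: (measurableT_comp measurable_stage_density mpair).
Qed.

(** The pointwise invariance equation is multiplied by [V] and integrated; Tonelli exchanges the two
    integrals. *)
Lemma invariance (V : R -> R) : measurable_fun setT V -> (forall y, D y -> 0 <= V y) ->
  (\int[mu]_(y in D) (V y * f y)%:E = \int[mu]_(x in D) flow V x)%E /\
  measurable_fun D (flow V).
Proof.
move=> mV V0.
(* [f] is measurable on [D] only; its extension by zero can be composed with the projection of the
   whole plane. *)
pose F (z : R * R) := ((f \_ D) z.1 * (V z.2 * q z.1 z.2))%:E.
have mfD : measurable_fun setT (f \_ D).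
  by apply/(measurable_restrictT f mD).
have mF : measurable_fun (D `*` D) F.
  apply/measurable_EFinP/measurable_funTS; apply: measurable_funM.
    exact: measurableT_comp.
  by apply: measurable_funM; [exact: measurableT_comp|exact: measurable_stage_density].
have fD x : D x -> (f \_ D) x = f x by move=> Dx; rewrite patchE mem_set.
have F0 x y : D x -> D y -> (0 <= F (x, y))%E.
  move=> Dx Dy; rewrite lee_fin /= fD// mulr_ge0 ?f0// mulr_ge0 ?V0//.
  exact: stage_density_ge0.
have [E mE] := @tonelli_setX _ _ _ _ _ mu mu D D F mD mD mF F0.
have flowE x : D x -> (\int[mu]_(y in D) F (x, y) = flow V x)%E.
  by move=> Dx; apply: eq_integral => y _; rewrite /F/= fD.
split; last first.
  by apply: eq_measurable_fun mE => x /set_mem Dx; exact: flowE.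
transitivity (\int[mu]_(x in D) \int[mu]_(y in D) F (x, y))%E; last first.
  by apply: eq_integral => x /set_mem Dx; exact: flowE.
rewrite E; apply: eq_integral => y /set_mem Dy.
rewrite EFinM fE// -ge0_integral_scale//.
- by apply: eq_integral => x /set_mem Dx; rewrite /F/= fD// mulrCA.
- by apply: measurable_funM => //; exact: measurable_q1.
- by move=> x Dx; rewrite mulr_ge0 ?f0// stage_density_ge0.
- exact: V0.
Qed.

Lemma flow_pow c i x : 0 <= c -> D x -> flow (fun y => c * y ^+ i) x =
  (c * f x * transition_moment i (lambda * x))%:E.
Proof.
move=> c0 Dx; rewrite EFinM -transition_momentE// -ge0_integral_scale//.
- by apply: eq_integral => y _; congr (_%:E); ring.
- apply: measurable_funM; [|exact: measurable_q].
  by apply: measurable_funTS; exact: measurable_funX.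
- by move=> y Dy; rewrite mulr_ge0 ?stage_density_ge0// exprn_ge0// D_ge0.
- by rewrite mulr_ge0// f0.
Qed.

Lemma le_flow (V1 V2 : R -> R) x : D x ->
  measurable_fun setT V1 -> measurable_fun setT V2 ->
  (forall y, D y -> 0 <= V1 y) -> (forall y, D y -> V1 y <= V2 y) ->
  (flow V1 x <= flow V2 x)%E.
Proof.
move=> Dx mV1 mV2 V0 V12.
have mV (V : R -> R) : measurable_fun setT V ->
    measurable_fun D (fun y => (f x * (V y * q x y))%:E).
  move=> mV; apply/measurable_EFinP; apply: measurable_funM => //.
  by apply: measurable_funM => //; exact: measurable_funTS.
apply: ge0_le_integral => //.
- by move=> y Dy; rewrite lee_fin mulr_ge0 ?f0// mulr_ge0 ?V0// stage_density_ge0.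
- exact: mV.
- exact: mV.
- by move=> y Dy; rewrite lee_fin ler_wpM2l ?f0// ler_wpM2r ?V12// stage_density_ge0.
Qed.

(** * Drift inequality and existence of moments *)

Let C k : R := let G := \int[mu]_(y in D) (y ^+ k * g y) in
  G + ((G * lambda) ^+ 2 + 1) / 2.

Let G0 k : 0 <= \int[mu]_(y in D) (y ^+ k * g y).
Proof. by apply: Rintegral_ge0 => y; exact: w0. Qed.

Let C0 k : 0 <= C k.
Proof. by rewrite /C addr_ge0 ?G0// divr_ge0// addr_ge0// sqr_ge0. Qed.

(** With [G] the [k]-th moment of [g], the linear bound is [G + G lambda x]. Then
    [2 G lambda x <= (G lambda)^2 + x^2] and [x^2 <= 1 + x^k] give the constant [C k] and the factor
    one half. *)
Lemma transition_moment_drift k x : (2 <= k)%N -> D x ->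
  transition_moment k (lambda * x) <= C k + x ^+ k / 2.
Proof.
move=> k2 Dx; have x0 := D_ge0 Dx.
apply: le_trans (transition_moment_le k _) _; first by rewrite mulr_ge0// ltW.
have x2 : x ^+ 2 <= 1 + x ^+ k.
  have [x1|/ltW x1] := leP x 1.
    by rewrite (@le_trans _ _ 1)// ?exprn_ile1// lerDl exprn_ge0.
  by rewrite (@le_trans _ _ (x ^+ k))// ?lerDr// ler_weXn2l.
rewrite /C; set G := Rintegral _ _ _.
have := sqr_ge0 (G * lambda - x); rewrite sqrrB => sq.
by rewrite mulrDr mulr1 -addrA lerD2l; lra.
Qed.

(** A bounded test function: its integral against [f] is finite before any moment of [f] is known to
    exist. *)
Let trunc k (n : nat) y : R := Num.min y n%:R ^+ k.

Let trunc_ge0 k n y : D y -> 0 <= trunc k n y.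
Proof. by move=> /D_ge0 y0; rewrite exprn_ge0// le_min y0 ler0n. Qed.

Let measurable_trunc k n : measurable_fun setT (trunc k n).
Proof. by apply: measurable_funX; exact: measurable_minr. Qed.

Let trunc_le k n y : D y -> trunc k n y <= n%:R ^+ k.
Proof.
move=> /D_ge0 y0; rewrite lerXn2r ?nnegrE ?ler0n// ?le_min ?y0 ?ler0n//.
by rewrite ge_min lexx orbT.
Qed.

(** The gain in the drift inequality: what remains of [x^k f(x)] after the loss of one half,
    restricted to [x <= n]. *)
Let head k (n : nat) x : R := (x <= n%:R)%R%:R * (x ^+ k / 2 * f x).

Let head_ge0 k n x : D x -> 0 <= head k n x.
Proof.
move=> Dx; rewrite mulr_ge0 ?ler0n// mulr_ge0 ?f0// divr_ge0//.
by rewrite exprn_ge0// D_ge0.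
Qed.

Let measurable_head k n : measurable_fun D (head k n).
Proof.
apply: measurable_funM; last first.
  apply: measurable_funM => //; apply: measurable_funTS.
  by apply: measurable_funM => //; exact: measurable_funX.
apply: measurable_funTS.
rewrite (_ : (fun x => _) = \1_(`]-oo, n%:R] : set R)).
  by apply: measurable_indic; exact: measurable_itv.
by apply/funext => x; rewrite indicE mem_setE in_itv.
Qed.

(* For [x <= n] the bound [C + x^k / 2] is used, and for [x > n] the trivial bound
   [n^k] coming from [transition_mass]. *)
Lemma trunc_drift k n x : (2 <= k)%N -> D x ->
  (flow (trunc k n) x + (head k n x)%:E <= (trunc k n x * f x + C k * f x)%:E)%E.
Proof.
move=> k2 Dx; have x0 := D_ge0 Dx.
rewrite /head; have [xn|nx] := leP x n%:R.
  have le1 : (flow (trunc k n) x <= ((C k + x ^+ k / 2) * f x)%:E)%E.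
    apply: (@le_trans _ _ (flow (fun y => 1 * y ^+ k) x)).
      apply: le_flow => //.
      - by apply: measurable_funM => //; exact: measurable_funX.
      - exact: trunc_ge0.
      - move=> y /D_ge0 y0; rewrite mul1r lerXn2r ?nnegrE ?le_min ?y0 ?ler0n//.
        by rewrite ge_min lexx.
    rewrite flow_pow// mul1r lee_fin mulrC ler_wpM2r ?f0//.
    exact: transition_moment_drift.
  apply: le_trans (leeD2r _ le1) _; rewrite -EFinD lee_fin /trunc.
  by rewrite (min_idPl xn) mul1r -!mulrDl ler_wpM2r ?f0//; lra.
have le1 : (flow (trunc k n) x <= (n%:R ^+ k * f x)%:E)%E.
  apply: (@le_trans _ _ (flow (fun y => n%:R ^+ k * y ^+ 0) x)).
    apply: le_flow => //.
    - by apply: measurable_funM => //; exact: measurable_funX.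
    - exact: trunc_ge0.
    - by move=> y Dy; rewrite expr0 mulr1 trunc_le.
  by rewrite flow_pow ?exprn_ge0// transition_mass ?mulr1// mulr_ge0// ltW.
apply: le_trans (leeD2r _ le1) _; rewrite -EFinD lee_fin /trunc.
by rewrite (min_idPr (ltW nx)) mul0r addr0 lerDl mulr_ge0 ?f0.
Qed.

(** When the drift inequality is integrated, invariance turns the [flow] term into the integral of
    [trunc k n y * f y], which cancels. The bound does not depend on [n]. *)
Lemma head_moment_le k n : (2 <= k)%N ->
  (\int[mu]_(x in D) (head k n x)%:E <= (C k)%:E)%E.
Proof.
move=> k2; have [E mF] := invariance (measurable_trunc k n) (@trunc_ge0 k n).
have mtf : measurable_fun D (fun y => trunc k n y * f y).
  by apply: measurable_funM => //; exact: measurable_funTS.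
have tf0 y : D y -> 0 <= trunc k n y * f y.
  by move=> Dy; rewrite mulr_ge0 ?f0 ?trunc_ge0.
have mEf : measurable_fun D (EFin \o f) by exact/measurable_EFinP.
have mCf : measurable_fun D (fun y => C k * f y) by exact: measurable_funM.
have F0 x : D x -> (0 <= flow (trunc k n) x)%E.
  move=> Dx; apply: integral_ge0 => y Dy.
  by rewrite lee_fin mulr_ge0 ?f0// mulr_ge0 ?trunc_ge0// stage_density_ge0.
(* Finiteness is what permits the cancellation. *)
have fin : (\int[mu]_(y in D) (trunc k n y * f y)%:E)%E \is a fin_num.
  rewrite ge0_fin_numE; last by apply: integral_ge0 => y Dy; rewrite lee_fin tf0.
  apply: (@le_lt_trans _ _ (\int[mu]_(y in D) (n%:R ^+ k * f y)%:E)%E).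
    apply: ge0_le_integral => //.
    - exact/measurable_EFinP.
    - by apply/measurable_EFinP; exact: measurable_funM.
    - by move=> y Dy; rewrite lee_fin ler_wpM2r ?f0// trunc_le.
  by rewrite ge0_integral_scale ?exprn_ge0// f_mass mule1 ltry.
rewrite -(leeD2lE _ _ fin) {1}E -ge0_integralD//; first last.
- by apply/measurable_EFinP; exact: measurable_head.
- by move=> x Dx; rewrite lee_fin head_ge0.
have -> : (\int[mu]_(y in D) (trunc k n y * f y)%:E + (C k)%:E =
    \int[mu]_(y in D) (trunc k n y * f y + C k * f y)%:E)%E.
  under [RHS]eq_integral do rewrite EFinD.
  rewrite ge0_integralD//.
  - by rewrite ge0_integral_scale// f_mass mule1.
  - exact/measurable_EFinP.
  - by move=> x Dx; rewrite lee_fin mulr_ge0 ?f0.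
  - exact/measurable_EFinP.
apply: ge0_le_integral => //.
- by move=> x Dx; rewrite adde_ge0 ?F0// lee_fin head_ge0.
- by apply: emeasurable_funD => //; apply/measurable_EFinP; exact: measurable_head.
- by apply/measurable_EFinP; exact: measurable_funD.
- by move=> x Dx; exact: trunc_drift.
Qed.

(** For [k >= 2], monotone convergence in [n] applied to the uniform bound on [head]; order 0 is the
    total mass, and order 1 follows from [x <= 1 + x^2]. *)
Lemma moment_integrable k : mu.-integrable D (EFin \o (fun x => f x * x ^+ k)).
Proof.
have mXf j : measurable_fun D (fun x => f x * x ^+ j).
  by apply: measurable_funM => //; apply: measurable_funTS; exact: measurable_funX.
have if0 : mu.-integrable D (EFin \o f).
  apply/integrableP; split; first exact/measurable_EFinP.
  under eq_integral => x /set_mem Dx do rewrite gee0_abs ?lee_fin ?f0//.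
  by rewrite f_mass ltry.
have i2 j : (2 <= j)%N -> mu.-integrable D (EFin \o (fun x => f x * x ^+ j)).
  move=> j2; apply/integrableP; split.
    by apply/measurable_EFinP; exact: mXf.
  have -> : (\int[mu]_(x in D) `|(EFin \o (fun x => f x * x ^+ j)%R) x| =
      2%:E * \int[mu]_(x in D) (x ^+ j / 2 * f x)%:E)%E.
    rewrite -ge0_integral_scale//.
    - apply: eq_integral => x /set_mem Dx; rewrite gee0_abs/=.
        by congr (_%:E); field.
      by rewrite lee_fin mulr_ge0 ?f0// exprn_ge0// D_ge0.
    - apply: measurable_funM => //; apply: measurable_funTS.
      by apply: measurable_funM => //; exact: measurable_funX.
    - move=> x Dx; rewrite mulr_ge0 ?f0// divr_ge0// exprn_ge0//.
      exact: D_ge0.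
  apply: lte_mul_pinfty; rewrite ?lee_fin//.
  apply: (@le_lt_trans _ _ (C j)%:E); last exact: ltry.
  (* At fixed [x] the sequence is constant once [n >= x]. *)
  have headE x : D x -> limn (fun n => (head j n x)%:E) = (x ^+ j / 2 * f x)%:E.
    move=> Dx; apply: cvg_lim => //.
    apply: cvg_near_cst; near=> n; rewrite /head.
    suff -> : (x <= n%:R)%R by rewrite mul1r.
    by near: n; exact: nbhs_infty_ger.
  have -> : (\int[mu]_(x in D) (x ^+ j / 2 * f x)%:E =
      \int[mu]_(x in D) limn (fun n => (head j n x)%:E))%E.
    by apply: eq_integral => x /set_mem Dx; rewrite headE.
  have nd x : D x -> {homo (fun n => (head j n x)%:E) : m n / (m <= n)%N >->
      (m <= n)%E}.
    move=> Dx m n mn; rewrite lee_fin ler_wpM2r//.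
      by rewrite mulr_ge0 ?f0// divr_ge0// exprn_ge0// D_ge0.
    rewrite ler_nat; have [xm|//] := leP x m%:R.
    by rewrite (le_trans xm)// ler_nat.
  rewrite monotone_convergence//.
  - apply: lime_le; last by apply: nearW => n; exact: head_moment_le.
    apply: ereal_nondecreasing_is_cvgn => m n mn.
    apply: ge0_le_integral => //.
    + by move=> x Dx; rewrite lee_fin head_ge0.
    + by apply/measurable_EFinP; exact: measurable_head.
    + by apply/measurable_EFinP; exact: measurable_head.
    + by move=> x Dx; exact: nd.
  - by move=> n; apply/measurable_EFinP; exact: measurable_head.
  - by move=> n x Dx; rewrite lee_fin head_ge0.
case: k => [|[|k]]; last exact: i2.
  by under eq_fun do rewrite expr0 mulr1; exact: if0.
apply: (@le_integrable _ _ _ mu D mD _ (fun x => (f x)%:E + (f x * x ^+ 2)%:E)%E).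
- by apply/measurable_EFinP; exact: (mXf 1).
- move=> x Dx; have x0 := D_ge0 Dx; rewrite -EFinD /= lee_fin.
  rewrite !ger0_norm ?addr_ge0 ?mulr_ge0 ?f0 ?exprn_ge0//.
  rewrite -{2}(mulr1 (f x)) -mulrDr ler_wpM2l ?f0//.
  have := sqr_ge0 (x - 1); rewrite sqrrB expr1n mulr1; nra.
- by apply: integrableD => //; exact: i2.
Unshelve. all: by end_near. Qed.

(** * Moments and density as integrals against [f] *)

Lemma moment0 : moment f 0 = 1.
Proof.
rewrite /moment (_ : (\int[_]_(x in _) _)%E = 1%E)// -f_mass.
by apply: eq_integral => x _; rewrite expr0 mul1r.
Qed.

Lemma moment_transition i :
  moment f i = \int[mu]_(x in D) (f x * transition_moment i (lambda * x)).
Proof.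
have mX : measurable_fun setT (fun y : R => 1 * y ^+ i).
  by apply: measurable_funM => //; exact: measurable_funX.
have X0 y : D y -> 0 <= 1 * y ^+ i by move=> /D_ge0 y0; rewrite mul1r exprn_ge0.
have [E _] := invariance mX X0.
rewrite /moment /Rintegral; congr fine.
transitivity (\int[mu]_(x in D) (1 * x ^+ i * f x)%:E)%E.
  by apply: eq_integral => x _; rewrite mul1r.
rewrite E; apply: eq_integral => x /set_mem Dx.
by rewrite flow_pow// mul1r.
Qed.

(** The invariance equation with [g y] taken out of the integral; the kernel grows linearly, so the
    moments of order 0 and 1 give integrability. *)
Lemma density_transition y : D y ->
  f y = g y * \int[mu]_(x in D)
    (f x * (expR (- (lambda * x)) + lambda * x * expR (- (lambda * x * H y)))).
Proof.
move=> Dy; rewrite mulrC -RintegralZr//.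
  rewrite -[LHS]/(fine (f y)%:E) fE// /Rintegral; congr fine.
  by apply: eq_integral => x _; rewrite /stage_density; congr (_%:E); ring.
apply: (@le_integrable _ _ _ mu D mD _
  (EFin \o (fun x => f x * x ^+ 0 + lambda * (f x * x ^+ 1)))).
- have ml : measurable_fun D (fun x : R => lambda * x) by exact: measurable_funM.
  apply/measurable_EFinP; apply: measurable_funM => //; apply: measurable_funD.
    by apply: measurableT_comp => //; exact: measurableT_comp.
  apply: measurable_funM => //; apply: measurableT_comp => //.
  by apply: measurableT_comp => //; exact: measurable_funM.
- move=> x Dx; have x0 := D_ge0 Dx.
  have lx0 : 0 <= lambda * x by rewrite mulr_ge0// ltW.
  rewrite /= lee_fin; apply: le_trans (ler_norm _).
  rewrite normrM ger0_norm ?f0// expr0 expr1 mulr1 (mulrCA lambda).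
  rewrite (_ : f x + f x * (lambda * x) = f x * (1 + lambda * x)).
    by rewrite ler_wpM2l ?f0// kernel_norm_le.
  by rewrite mulrDr mulr1.
- by have := @integrableD _ _ _ mu D mD _ _ (moment_integrable 0)
    (@integrable_scale _ _ _ mu D lambda _ mD (moment_integrable 1)).
Qed.

(** The common form of both series: Abel summation under the integral with weight [f] and
    [t x = lambda * x]. *)
Lemma Rintegral_moment_sum (c : R^nat) (psi : R -> R) (B S : R) :
  (forall s, 0 <= s -> series (fun k => (- s) ^+ k / k`!%:R * c k) @ \oo --> psi s) ->
  (forall s, 0 <= s -> `|psi s| <= B * (1 + s)) ->
  series (fun k => (-1) ^+ k * (lambda ^+ k * moment f k / k`!%:R) * c k) @ \oo
    --> S ->
  \int[mu]_(x in D) (f x * psi (lambda * x)) = S.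
Proof.
move=> psiE psi_le cS.
have lx0 x : D x -> 0 <= lambda * x by move=> /D_ge0; exact/mulr_ge0/ltW.
have E k : (fun x => f x * (lambda * x) ^+ k) =
    (fun x => lambda ^+ k * (f x * x ^+ k)).
  by apply/funext => x; rewrite exprMn mulrCA.
have iwt k : mu.-integrable D (EFin \o (fun x => f x * (lambda * x) ^+ k)).
  by rewrite E; apply: integrable_scale => //; exact: moment_integrable.
apply: (@Rintegral_abel_sum _ _ _ mu D mD f (fun x => lambda * x) c psi B S f0
  lx0 iwt psiE psi_le _).2.
rewrite (_ : (fun k => _) = (fun k =>
  (-1) ^+ k * (lambda ^+ k * moment f k / k`!%:R) * c k))//.
apply/funext => k; rewrite E RintegralZl//; last exact: moment_integrable.
rewrite (_ : \int[mu]_(x in D) (f x * x ^+ k) = moment f k); first by ring.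
by rewrite /moment /Rintegral; under eq_integral do rewrite mulrC.
Qed.

End chain.

(** Passes from sums starting at 2 to full power series. Only agreement from 2 on is asked, as the
    natural terms 0 and 1 need not follow the formula for [v]. *)
Lemma cvg_series_from2 (R : realType) (u v : R^nat) :
  (forall k, (2 <= k)%N -> u k = v k) ->
  cvgn (fun n => \sum_(2 <= k < n) v k) ->
  series u @ \oo --> u 0%N + u 1%N + limn (fun n => \sum_(2 <= k < n) v k).
Proof.
move=> uv cv; rewrite -(cvg_shiftn 2).
have -> : (fun n => series u (n + 2)%N) =
    (fun n => u 0%N + u 1%N + \sum_(2 <= k < (n + 2)%N) v k).
  apply/funext => n; rewrite /series/= addn2 big_ltn// big_ltn// addrA.
  by congr (_ + _); apply: eq_big_nat => k /andP[? _]; exact: uv.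
by apply: cvgD; [exact: cvg_cst|rewrite (cvg_shiftn 2 (fun n => \sum_(2 <= k < n) v k))].
Qed.

Theorem proposition4 (d : measure_display) (T : measurableType d)
    (R : realType) (P : probability T R) (sigma : nat -> {RV P >-> R})
    (lambda : R) (g f : R -> R)
    (lambda_gt0 : 0 < lambda)
    (hsigma : service_times P sigma g)
    (hf : invariant_density (stage_density lambda (Gbar P sigma) g) f) :
  let beta := moment f in
  let a (k : nat) : R := (-1) ^+ k * (lambda ^+ k * beta k / k`!%:R) in
  let system_sum (i n : nat) : R :=
    \sum_(2 <= j < n) a j * (gamma P sigma i 1 - gamma P sigma i j) in
  let density_sum (y : R) (n : nat) : R :=
    \sum_(2 <= k < n) a k * (1 - k%:R * Gbar P sigma y ^+ k.-1) in
  [/\ forall k : nat, (1 <= k)%N ->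
        lebesgue_measure.-integrable (half_line R)
          (fun x => (x ^+ k * f x)%:E),
      forall i : nat, (2 <= i)%N -> cvgn (system_sum i) ->
        beta i = gamma P sigma i 1 + limn (system_sum i) &
      forall y : R, 0 <= y -> cvgn (density_sum y) ->
        f y = g y * (1 + limn (density_sum y))].
Proof.
move=> beta a system_sum density_sum; split.
- move=> k _; have := moment_integrable lambda_gt0 hsigma hf k.
  by under eq_fun do rewrite mulrC.
- move=> i i2 cs.
  (* The integral form is the right coefficient at [k = 0], where it is [gamma i 1] rather than a
     difference. *)
  pose c k := \int[lebesgue_measure]_(y in half_line R)
    (y ^+ i * g y * (1 - k%:R * Gbar P sigma y ^+ k.-1)).
  have cE k : (0 < k)%N -> c k = gamma P sigma i 1 - gamma P sigma i k.
    exact: Rintegral_min_coeff.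
  have c0 : c 0%N = gamma P sigma i 1.
    rewrite (gammaE hsigma); apply: eq_Rintegral => y _.
    by rewrite mul0r subr0 expr0 mulr1.
  have uv k : (2 <= k)%N ->
      a k * c k = a k * (gamma P sigma i 1 - gamma P sigma i k).
    by move=> k2; rewrite cE// (leq_trans _ k2).
  have := cvg_series_from2 uv cs.
  (* The term of index 1 vanishes, and since [beta 0 = 1] the term of index 0 is the leading
     [gamma i 1]. *)
  rewrite (cE 1%N)// subrr mulr0 addr0 c0 /a /beta (moment0 hf).
  rewrite !expr0 fact0 divr1 !mul1r => S.
  rewrite (moment_transition lambda_gt0 hsigma hf).
  (* Here [psi] is [transition_moment i], and [B] is the [i]-th moment of [g]. *)
  apply: (Rintegral_moment_sum lambda_gt0 hsigma hf _ _ S).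
    by move=> s s0; exact: (transition_moment_series hsigma i s0).2.
  move=> s s0; rewrite ger0_norm ?transition_moment_ge0//.
  exact: transition_moment_le.
- move=> y y0 cs.
  have Dy : half_line R y by rewrite /half_line/= in_itv/= y0.
  pose c k : R := 1 - k%:R * Gbar P sigma y ^+ k.-1.
  have := @cvg_series_from2 _ (fun k => a k * c k) _ (fun _ _ => erefl) cs.
  rewrite /a /c /beta (moment0 hf) /= !expr0 fact0 divr1 !mul1r mul0r subr0.
  (* Again index 1 contributes nothing, now because [1 - H y ^+ 0 = 0]; index 0 gives the leading
     1. *)
  rewrite subrr mulr0 addr0 => S.
  rewrite (density_transition lambda_gt0 hsigma hf Dy); congr (_ * _).
  apply: (Rintegral_moment_sum lambda_gt0 hsigma hf _ _ S
    (psi := fun s => expR (- s) + s * expR (- (s * Gbar P sigma y))) (B := 1)).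
    by move=> s s0; exact: cvg_series_min_kernel.
  by move=> s s0; rewrite mul1r; exact: (kernel_norm_le hsigma).
Qed.
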